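(* $$3^{\gamma-\frac{\log 3}{2}}=\prod_{m=1}^{\infty}\frac{(3m)^{\frac{1}{3m}}\cdot(3m)^{\frac{1}{3m}}}{(3m-1)^{\frac{1}{3m-1}}\cdot(3m+1)^{\frac{1}{3m+1}}}=\frac{3^{\frac{1}{3}}\cdot3^{\frac{1}{3}}}{2^{\frac{1}{2}}\cdot4^{\frac{1}{4}}}\,\frac{6^{\frac{1}{6}}\cdot6^{\frac{1}{6}}}{5^{\frac{1}{5}}\cdot7^{\frac{1}{7}}}\,\frac{9^{\frac{1}{9}}\cdot9^{\frac{1}{9}}}{8^{\frac{1}{8}}\cdot10^{\frac{1}{10}}}\cdots .$$
   Context: $\gamma=0.5772156649\ldots$ is the Euler–Mascheroni constant and $\log$ is the natural logarithm. The infinite product is the limit of its partial products over $m$. *)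

(* Defs.v *)
From Stdlib Require Import Reals Lra Lia.
From Coquelicot Require Import Coquelicot.
Open Scope R_scope.

(* [1 + 1/2 + ... + 1/n - log n]. The entry at [n = 0] is a junk value,
   irrelevant to the limit. *)
Definition harmonic_minus_log (n : nat) : R :=
  sum_n_m (fun k : nat => / INR k) 1 n - ln (INR n).

Definition euler_gamma : R := real (Lim_seq harmonic_minus_log).

(* [Lim_seq] and [real] are total functions: [is_lim_seq_euler_gamma]
   below shows that [euler_gamma] is a genuine limit. *)
Lemma ln_le_sub1 (x : R) : 0 < x -> ln x <= x - 1.
Proof.
  intros Hx.
  pose proof (exp_ineq1_le (ln x)) as H.
  rewrite (exp_ln x Hx) in H; lra.
Qed.

Lemma ln_succ_bounds (n : nat) : (1 <= n)%nat ->
  / INR (S n) <= ln (INR (S n)) - ln (INR n) <= / INR n.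
Proof.
  intros Hn.
  assert (H0 : 0 < INR n) by (apply lt_0_INR; lia).
  rewrite S_INR.
  assert (H1 : 0 < INR n + 1) by lra.
  split.
  - assert (H : ln (INR n / (INR n + 1)) <= INR n / (INR n + 1) - 1)
      by (apply ln_le_sub1; apply Rdiv_lt_0_compat; lra).
    rewrite ln_div in H by lra.
    replace (INR n / (INR n + 1) - 1) with (- / (INR n + 1)) in H
      by (field; lra).
    lra.
  - assert (H : ln ((INR n + 1) / INR n) <= (INR n + 1) / INR n - 1)
      by (apply ln_le_sub1; apply Rdiv_lt_0_compat; lra).
    rewrite ln_div in H by lra.
    replace ((INR n + 1) / INR n - 1) with (/ INR n) in H by (field; lra).
    lra.
Qed.

Lemma harmonic_minus_log_S (n : nat) :
  harmonic_minus_log (S (S n)) =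
  harmonic_minus_log (S n) + / INR (S (S n))
  - (ln (INR (S (S n))) - ln (INR (S n))).
Proof.
  unfold harmonic_minus_log.
  rewrite (sum_n_Sm _ 1 (S n)) by lia.
  change plus with Rplus; lra.
Qed.

Lemma harmonic_minus_log_ge (n : nat) :
  / INR (S n) <= harmonic_minus_log (S n).
Proof.
  induction n as [|n IH].
  - unfold harmonic_minus_log; rewrite sum_n_n; simpl; rewrite ln_1; lra.
  - rewrite harmonic_minus_log_S.
    pose proof (ln_succ_bounds (S n) ltac:(lia)); lra.
Qed.

Lemma is_lim_seq_euler_gamma : is_lim_seq harmonic_minus_log euler_gamma.
Proof.
  apply (Lim_seq_correct' harmonic_minus_log).
  cut (ex_finite_lim_seq (fun n => harmonic_minus_log (S n))).
  { intros [l Hl]; exists l; apply is_lim_seq_incr_1; exact Hl. }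
  apply ex_finite_lim_seq_decr with (M := 0); intros n.
  - rewrite harmonic_minus_log_S.
    pose proof (ln_succ_bounds (S n) ltac:(lia)); lra.
  - pose proof (harmonic_minus_log_ge n) as H.
    assert (0 < / INR (S n)) by (apply Rinv_0_lt_compat, lt_0_INR; lia).
    lra.
Qed.

(* [a 1 * a 2 * ... * a n]; the value [a 0] is never used. *)
Fixpoint partial_prod (a : nat -> R) (n : nat) : R :=
  match n with
  | O => 1
  | S p => partial_prod a p * a (S p)
  end.

Definition is_infinite_prod (a : nat -> R) (l : R) : Prop :=
  is_lim_seq (partial_prod a) l.

(* Meaningful for [1 <= m], when the three bases are positive; [Rpower x y] is
   [x ^ y] only for [0 < x]. *)
Definition prod_factor (m : nat) : R :=
  let t := 3 * INR m in
  (Rpower t (1 / t) * Rpower t (1 / t))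
  / (Rpower (t - 1) (1 / (t - 1)) * Rpower (t + 1) (1 / (t + 1))).

(* Main.v *)
Require Import Defs.
From Stdlib Require Import Reals Lra Lia.
From Coquelicot Require Import Coquelicot.
Open Scope R_scope.

(** Put [f x = ln x / x], [H n = 1 + ... + 1/n] and [S n = f 1 + ... + f n].
    The logarithm of the [m]-th factor is
    [2 f (3m) - f (3m - 1) - f (3m + 1)], that is, [3 f (3m)] minus the sum of
    [f] over the block [3m - 1, 3m, 3m + 1].  These blocks tile the integers
    from [2] to [3n + 1], and [f 1 = 0]; moreover
    [3 f (3m) = ln 3 / m + f m].  Hence the [n]-th partial product is the
    exponential of
    [ln 3 * H n + S n - S (3n + 1)] ([partial_prod_factor_exp]).

    Since [f] is the derivative of [ln x ^ 2 / 2] and decreases from [x = 3]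
    on, comparison with the integral shows that [A n = S n - ln n ^ 2 / 2]
    converges ([stieltjes_seq_cv]; the limit is the first Stieltjes constant).
    So [A n - A (3n)] tends to [0], the value of the Stieltjes constant
    cancels, and, [f (3n + 1)] being negligible, the exponent is
    [ln 3 * (H n - ln n) + (ln 3 * ln n + ln n ^ 2 / 2 - ln (3n) ^ 2 / 2)]
    up to [o(1)].  The second bracket equals [- ln 3 ^ 2 / 2] for every [n],
    and the first one tends to [euler_gamma]. *)

Definition log_quot (x : R) : R := ln x / x.

Lemma one_le_ln (x : R) : 3 <= x -> 1 <= ln x.
Proof.
  intros Hx.
  rewrite <- (ln_exp 1).
  apply ln_le; [apply exp_pos|].
  pose proof exp_le_3; lra.
Qed.

(** Cross-multiplied, the claim is [x (ln y - ln x) <= (y - x) ln x]: the left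
    side is at most [y - x] by concavity of [ln], and [1 <= ln x]. *)
Lemma log_quot_decr (x y : R) : 3 <= x -> x <= y -> log_quot y <= log_quot x.
Proof.
  intros Hx Hxy.
  pose proof (one_le_ln x Hx) as Hl.
  assert (H : x * (ln y - ln x) <= y - x).
  { assert (H : ln (y / x) <= y / x - 1)
      by (apply ln_le_sub1, Rdiv_lt_0_compat; lra).
    rewrite ln_div in H by lra.
    replace (y - x) with (x * (y / x - 1)) by (field; lra).
    apply Rmult_le_compat_l; lra. }
  unfold log_quot.
  apply (Rmult_le_reg_r (x * y)); [nra|].
  replace (ln y / y * (x * y)) with (x * ln y) by (field; lra).
  replace (ln x / x * (x * y)) with (y * ln x) by (field; lra).
  nra.
Qed.

(** The middle term is the integral of [log_quot] over [[x, x + 1]]; the mean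
    value theorem makes it a value of [log_quot] inside that interval. *)
Lemma log_quot_int_bounds (x : R) : 3 <= x ->
  log_quot (x + 1) <= ln (x + 1) ^ 2 / 2 - ln x ^ 2 / 2 <= log_quot x.
Proof.
  intros Hx.
  destruct (MVT_cor2 (fun t => ln t ^ 2 / 2) log_quot x (x + 1))
    as [c [Hc Hxc]]; [lra| |].
  - intros t Ht.
    apply is_derive_Reals; unfold log_quot.
    auto_derive; [lra|field; lra].
  - rewrite Hc; replace (x + 1 - x) with 1 by ring.
    pose proof (log_quot_decr x c Hx ltac:(lra)).
    pose proof (log_quot_decr c (x + 1) ltac:(lra) ltac:(lra)).
    lra.
Qed.

Lemma log_quot_lim : is_lim_seq (fun n => log_quot (INR n)) 0.
Proof.
  apply (is_lim_comp_seq log_quot INR p_infty 0).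
  - exact is_lim_div_ln_p.
  - exists 0%nat; intros n _; discriminate.
  - exact is_lim_seq_INR.
Qed.

Definition log_quot_sum (n : nat) : R :=
  sum_n_m (fun k => log_quot (INR k)) 1 n.

Lemma log_quot_sum_S (n : nat) :
  log_quot_sum (S n) = log_quot_sum n + log_quot (INR (S n)).
Proof. exact (sum_n_Sm _ 1 n ltac:(lia)). Qed.

Definition stieltjes_seq (n : nat) : R :=
  log_quot_sum n - ln (INR n) ^ 2 / 2.

Lemma stieltjes_seq_bounds (n : nat) : (3 <= n)%nat ->
  stieltjes_seq n - log_quot (INR n)
    <= stieltjes_seq (S n) - log_quot (INR (S n))
  /\ stieltjes_seq (S n) <= stieltjes_seq n.
Proof.
  intros Hn.
  assert (Hx : 3 <= INR n)
    by (replace 3 with (INR 3) by (simpl; lra); apply le_INR, Hn).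
  pose proof (log_quot_int_bounds (INR n) Hx) as H.
  unfold stieltjes_seq; rewrite log_quot_sum_S, S_INR; lra.
Qed.

(** From [n = 3] on the sequence decreases, while it stays above the increasing
    sequence [stieltjes_seq n - log_quot n]. *)
Lemma stieltjes_seq_cv : exists l : R, is_lim_seq stieltjes_seq l.
Proof.
  cut (ex_finite_lim_seq (fun n => stieltjes_seq (n + 3))).
  { intros [l Hl]; exists l.
    apply (is_lim_seq_incr_n stieltjes_seq 3); exact Hl. }
  apply ex_finite_lim_seq_decr
    with (M := stieltjes_seq 3 - log_quot (INR 3)); intros n.
  - apply (stieltjes_seq_bounds (n + 3)); lia.
  - assert (H : stieltjes_seq 3 - log_quot (INR 3)
                <= stieltjes_seq (n + 3) - log_quot (INR (n + 3))).
    { induction n as [|n IH]; [apply Rle_refl|].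
      apply (Rle_trans _ _ _ IH), (stieltjes_seq_bounds (n + 3)); lia. }
    assert (Hx : 3 <= INR (n + 3))
      by (rewrite plus_INR; simpl; pose proof (pos_INR n); lra).
    assert (0 < log_quot (INR (n + 3))).
    { pose proof (one_le_ln _ Hx); apply Rdiv_lt_0_compat; lra. }
    lra.
Qed.

Lemma prod_factor_exp (m : nat) :
  let t := 3 * INR m in
  prod_factor m = exp (2 * log_quot t - log_quot (t - 1) - log_quot (t + 1)).
Proof.
  intros t; unfold prod_factor; fold t; unfold Rpower, log_quot.
  unfold Rdiv; rewrite <- !exp_plus, <- exp_Ropp, <- exp_plus.
  f_equal; ring.
Qed.

Lemma log_quot_triple (x : R) : 0 < x ->
  3 * log_quot (3 * x) = ln 3 * / x + log_quot x.
Proof.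
  intros Hx; unfold log_quot; rewrite ln_mult by lra; field; lra.
Qed.

(** The step from [n] to [n + 1] adds to [log_quot_sum (3 * n + 1)] exactly the
    three integers [t - 1], [t], [t + 1] around [t = 3 (n + 1)]. *)
Lemma partial_prod_factor_exp (n : nat) :
  partial_prod prod_factor n =
  exp (ln 3 * sum_n_m (fun k => / INR k) 1 n
       + log_quot_sum n - log_quot_sum (3 * n + 1)).
Proof.
  induction n as [|n IH].
  - unfold log_quot_sum; simpl.
    rewrite sum_n_n, !sum_n_m_zero by lia.
    change zero with 0; unfold log_quot; simpl; rewrite ln_1.
    rewrite <- exp_0 at 1; f_equal; field.
  - cbn [partial_prod]; rewrite IH, prod_factor_exp, <- exp_plus.
    f_equal.
    rewrite (sum_n_Sm _ 1 n) by lia; change plus with Rplus.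
    replace (3 * S n + 1)%nat with (S (S (S (3 * n + 1)))) by lia.
    rewrite !log_quot_sum_S.
    assert (H : INR (3 * n + 1) = 3 * INR (S n) - 2)
      by (rewrite S_INR, plus_INR, mult_INR; simpl; ring).
    rewrite (S_INR (S (S (3 * n + 1)))), (S_INR (S (3 * n + 1))),
      (S_INR (3 * n + 1)), H.
    replace (3 * INR (S n) - 2 + 1) with (3 * INR (S n) - 1) by ring.
    replace (3 * INR (S n) - 1 + 1) with (3 * INR (S n)) by ring.
    pose proof (log_quot_triple (INR (S n)) ltac:(apply lt_0_INR; lia)).
    lra.
Qed.

Lemma log_partial_prod_decomp (n : nat) : (1 <= n)%nat ->
  ln 3 * sum_n_m (fun k => / INR k) 1 n
    + log_quot_sum n - log_quot_sum (3 * n + 1)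
  = ln 3 * harmonic_minus_log n - ln 3 ^ 2 / 2
    + (stieltjes_seq n - stieltjes_seq (3 * n))
    - log_quot (INR (3 * n + 1)).
Proof.
  intros Hn.
  assert (0 < INR n) by (apply lt_0_INR; lia).
  replace (3 * n + 1)%nat with (S (3 * n)) by lia.
  rewrite log_quot_sum_S.
  unfold harmonic_minus_log, stieltjes_seq.
  replace (ln (INR (3 * n))) with (ln 3 + ln (INR n)).
  - field.
  - rewrite mult_INR, <- ln_mult by (simpl; lra).
    f_equal; simpl; ring.
Qed.

Lemma log_partial_prod_lim :
  is_lim_seq (fun n => ln 3 * sum_n_m (fun k => / INR k) 1 n
                       + log_quot_sum n - log_quot_sum (3 * n + 1))
    (ln 3 * euler_gamma - ln 3 ^ 2 / 2).
Proof.
  destruct stieltjes_seq_cv as [l Hl].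
  assert (H3 : is_lim_seq (fun n => stieltjes_seq (3 * n)) l).
  { apply (is_lim_seq_subseq stieltjes_seq l (fun n => 3 * n)%nat); [|exact Hl].
    apply eventually_subseq; intros n; lia. }
  assert (Hf : is_lim_seq (fun n => log_quot (INR (3 * n + 1))) 0).
  { apply (is_lim_seq_subseq (fun n => log_quot (INR n)) 0
             (fun n => 3 * n + 1)%nat); [|exact log_quot_lim].
    apply eventually_subseq; intros n; lia. }
  eapply is_lim_seq_ext_loc.
  - exists 1%nat; intros n Hn; symmetry; exact (log_partial_prod_decomp n Hn).
  - replace (ln 3 * euler_gamma - ln 3 ^ 2 / 2)
      with (ln 3 * euler_gamma - ln 3 ^ 2 / 2 + (l - l) - 0) by ring.
    apply is_lim_seq_minus'; [|exact Hf].
    apply is_lim_seq_plus'; [|exact (is_lim_seq_minus' _ _ _ _ Hl H3)].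
    apply is_lim_seq_minus'; [|apply is_lim_seq_const].
    apply (is_lim_seq_scal_l _ (ln 3) euler_gamma), is_lim_seq_euler_gamma.
Qed.

Theorem mainTheorem7 :
  is_infinite_prod prod_factor (Rpower 3 (euler_gamma - ln 3 / 2))
  /\ prod_factor 1 =
       (Rpower 3 (1 / 3) * Rpower 3 (1 / 3))
       / (Rpower 2 (1 / 2) * Rpower 4 (1 / 4))
  /\ prod_factor 2 =
       (Rpower 6 (1 / 6) * Rpower 6 (1 / 6))
       / (Rpower 5 (1 / 5) * Rpower 7 (1 / 7))
  /\ prod_factor 3 =
       (Rpower 9 (1 / 9) * Rpower 9 (1 / 9))
       / (Rpower 8 (1 / 8) * Rpower 10 (1 / 10)).
Proof.
  split; [|repeat split].
  - unfold is_infinite_prod, Rpower.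
    eapply is_lim_seq_ext;
      [intros n; symmetry; apply partial_prod_factor_exp|].
    replace ((euler_gamma - ln 3 / 2) * ln 3)
      with (ln 3 * euler_gamma - ln 3 ^ 2 / 2) by field.
    apply (is_lim_seq_continuous exp); [|exact log_partial_prod_lim].
    apply derivable_continuous_pt, derivable_pt_exp.
  - unfold prod_factor.
    replace (3 * INR 1) with 3 by (simpl; ring).
    replace (3 - 1) with 2 by ring; replace (3 + 1) with 4 by ring.
    reflexivity.
  - unfold prod_factor.
    replace (3 * INR 2) with 6 by (simpl; ring).
    replace (6 - 1) with 5 by ring; replace (6 + 1) with 7 by ring.
    reflexivity.
  - unfold prod_factor.
    replace (3 * INR 3) with 9 by (simpl; ring).
    replace (9 - 1) with 8 by ring; replace (9 + 1) with 10 by ring.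
    reflexivity.
Qed.
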